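(* Let $\lambda>0$, $\tau>0$ and $\delta\in(0,1/2)$. Let $\sigma=\Theta\left(\frac{\eta R}{n}\sqrt{\frac{\log(d/\delta)}{m}}\right)$ satisfy $$\sigma\;\geq\;\frac{2c\eta R}{n}\sqrt{\frac{\log(d/\delta)}{m}},$$ where $c$ is the universal constant in the Johnson–Lindenstrauss (JL) lemma. Let $$\mathbf w_*=\arg\min_{\mathbf w\in\mathbb R^d}\ \frac{1}{2n}\|X\mathbf w-\mathbf y\|_2^2+\frac{\lambda}{2}\|\mathbf w\|_2^2+\tau\|\mathbf w\|_1,$$ $$\widehat{\mathbf w}_*=\arg\min_{\mathbf w\in\mathbb R^d}\ \frac{1}{2n}\|\widehat X\mathbf w-\widehat{\mathbf y}\|_2^2+\frac{\lambda}{2}\|\mathbf w\|_2^2+(\tau+\sigma)\|\mathbf w\|_1,$$ where $\widehat X=AX$ and $\widehat{\mathbf y}=A\mathbf y$, and let $s$ be the number of nonzero entries of $\mathbf w_*$. Then with probability at least $1-\delta$ (over the random matrix $A$), for $p=1$ or $2$, $$\|\widehat{\mathbf w}_*-\mathbf w_*\|_p\;\leq\; O\left(\frac{\eta R}{n\lambda}\sqrt{\frac{s^{2/p}\log(d/\delta)}{m}}\right).$$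
   Context: Setting: $X=(\bar{\mathbf x}_1,\ldots,\bar{\mathbf x}_d)\in\mathbb R^{n\times d}$ is a fixed (deterministic) data matrix with columns $\bar{\mathbf x}_j$, and $\mathbf y\in\mathbb R^n$ is a fixed target vector. $R$ is an upper bound on the column norms: $\max_{1\le j\le d}\|\bar{\mathbf x}_j\|_2\le R$. Put $\mathbf e=X\mathbf w_*-\mathbf y$; $\eta$ is a number with $\|\mathbf e\|_2\le\eta$. $A\in\mathbb R^{m\times n}$ is a random matrix (a JL transform) obeying the JL lemma: for every fixed vector $\mathbf x\in\mathbb R^n$ and every failure probability $\delta\in(0,1/2)$, with probability at least $1-\delta$, $$\left|\|A\mathbf x\|_2^2-\|\mathbf x\|_2^2\right|\le c\sqrt{\frac{\log(1/\delta)}{m}}\,\|\mathbf x\|_2^2,$$ where $c>0$ is a universal constant. The value of $c$ is unspecified: $c$ denotes a fixed, sufficiently large absolute constant for which this holds. $\sigma=\Theta(B)$ means that $\sigma$ lies between two positive absolute constant multiples of $B$. The constant hidden in $O(\cdot)$ depends only on $c$ and on the constants implicit in $\Theta(\cdot)$, not on $n,d,m,s,\lambda,\tau,\eta,R,\delta$. *)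

(* Defs.v *)
From HB Require Import structures.
From mathcomp Require Import all_boot all_order all_algebra.
From mathcomp Require Import all_classical all_reals all_analysis.

Set Implicit Arguments.
Unset Strict Implicit.
Unset Printing Implicit Defensive.

Import Order.TTheory GRing.Theory Num.Theory.

Local Open Scope classical_set_scope.
Local Open Scope ring_scope.

(* The norm that MathComp-Analysis puts on matrices is the sup norm, hence
   this definition. *)
Definition lpnorm (R : realType) (p : R) (k : nat) (v : 'cV[R]_k) : R :=
  (\sum_(i < k) `|v i 0| `^ p) `^ p^-1.

Definition nnz (R : realType) (k : nat) (v : 'cV[R]_k) : nat :=
  #|[set i : 'I_k | v i 0 != 0]%SET|.

(* [N] is separate from the number [k] of rows: the sketched problem has [m]
   rows, but its loss is still divided by [2n]. *)
Definition elastic_net (R : realType) (N k d : nat) (X : 'M[R]_(k, d))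
    (y : 'cV[R]_k) (lambda tau : R) (w : 'cV[R]_d) : R :=
  (2 * N%:R)^-1 * lpnorm 2 (X *m w - y) ^+ 2
  + lambda / 2 * lpnorm 2 w ^+ 2
  + tau * lpnorm 1 w.

Definition is_argmin (R : realType) (V : Type) (f : V -> R) (w : V) : Prop :=
  forall v : V, f w <= f v.

(* "With probability at least [q], [Q] holds".  The intermediate event spares
   us a measurability side condition on [Q]; for measurable [Q] this is just
   [q <= P Q], see [with_prob_geE]. *)
Definition with_prob_ge (disp : measure_display) (T : measurableType disp)
    (R : realType) (P : probability T R) (q : R) (Q : set T) : Prop :=
  exists E : set T, [/\ measurable E, (q%:E <= P E)%E & E `<=` Q].

Lemma with_prob_geE (disp : measure_display) (T : measurableType disp)
    (R : realType) (P : probability T R) (q : R) (Q : set T) :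
  measurable Q -> with_prob_ge P q Q <-> (q%:E <= P Q)%E.
Proof.
move=> mQ; split=> [[E [mE qE EQ]]|qQ]; last by exists Q; split.
by apply: (le_trans qE); apply: le_measure => //; rewrite inE.
Qed.

Definition random_mx (disp : measure_display) (T : measurableType disp)
    (R : realType) (P : probability T R) (m n : nat)
    (A : 'I_m -> 'I_n -> {RV P >-> R}) (omega : T) : 'M[R]_(m, n) :=
  \matrix_(i < m, j < n) A i j omega.

Definition JL_transform (disp : measure_display) (T : measurableType disp)
    (R : realType) (P : probability T R) (m n : nat)
    (A : 'I_m -> 'I_n -> {RV P >-> R}) (c : R) : Prop :=
  forall (x : 'cV[R]_n) (delta : R), 0 < delta -> delta < 1 / 2 ->
    with_prob_ge P (1 - delta)
      [set omega |
        `| lpnorm 2 (random_mx A omega *m x) ^+ 2 - lpnorm 2 x ^+ 2 |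
        <= c * Num.sqrt (ln (1 / delta) / m%:R) * lpnorm 2 x ^+ 2].

(* sigma = Theta(B), with explicit implicit constants. *)
Definition is_Theta (R : realType) (a b B sigma : R) : Prop :=
  a * B <= sigma /\ sigma <= b * B.

(* Main.v *)
(** Write [v = what - wstar] and [e = X *m wstar - y].  Subtracting the
    first-order optimality condition of [wstar] from the inequality between the
    sketched objectives at [what] and [wstar] cancels [tau] and leaves
    [lambda/2 |v|_2^2 + sigma (|wstar + v|_1 - |wstar|_1) <= <g, v>], where
    [g = X^T (I - A^T A) e / n].  Polarizing the JL bound and a union bound over
    the columns of [X] give [|g|_oo <= 3/4 sigma]; here
    [ln (2 d / delta) <= 2 ln (d / delta)] absorbs the [2 d] events of the union
    bound, and the slack [3/4 < 1] makes
    [v] concentrate on the support of [wstar], so that Cauchy-Schwarz on the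
    support concludes. *)

Require Import Defs.
From HB Require Import structures.
From mathcomp Require Import all_boot all_order all_algebra.
From mathcomp Require Import all_classical all_reals all_analysis.
From mathcomp Require Import ring lra.

Set Implicit Arguments.
Unset Strict Implicit.
Unset Printing Implicit Defensive.

Import Order.TTheory GRing.Theory Num.Theory.

Local Open Scope classical_set_scope.
Local Open Scope ring_scope.

(** * Inner product and norms *)

(* Locked, as is [l1norm]: unification between distinct [lpnorm] terms unfolds
   [powR] and diverges. *)
HB.lock Definition dotv (R : realType) (k : nat) (u v : 'cV[R]_k) : R :=
  \sum_(i < k) u i 0 * v i 0.

HB.lock Definition l1norm (R : realType) (k : nat) (u : 'cV[R]_k) : R :=
  \sum_(i < k) `|u i 0|.

Section dotv_theory.
Context {R : realType} {k : nat}.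
Implicit Types (u v w : 'cV[R]_k) (t : R).

Lemma dotvC u v : dotv u v = dotv v u.
Proof. by rewrite dotv.unlock; apply: eq_bigr => i _; rewrite mulrC. Qed.

Lemma dotvDl u v w : dotv (u + v) w = dotv u w + dotv v w.
Proof.
rewrite dotv.unlock -big_split.
by apply: eq_bigr => i _; rewrite mxE mulrDl.
Qed.

Lemma dotvZl t u w : dotv (t *: u) w = t * dotv u w.
Proof.
by rewrite dotv.unlock mulr_sumr; apply: eq_bigr => i _; rewrite mxE mulrA.
Qed.

Lemma dotvDr u v w : dotv w (u + v) = dotv w u + dotv w v.
Proof. by rewrite dotvC dotvDl !(dotvC w). Qed.

Lemma dotvZr t u w : dotv w (t *: u) = t * dotv w u.
Proof. by rewrite dotvC dotvZl (dotvC w). Qed.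

Lemma dotv0 u : dotv u 0 = 0.
Proof. by rewrite -(scale0r u) dotvZr mul0r. Qed.

Lemma dotvvE u : dotv u u = \sum_(i < k) u i 0 ^+ 2.
Proof. by rewrite dotv.unlock; apply: eq_bigr => i _; rewrite expr2. Qed.

Lemma dotvv_ge0 u : 0 <= dotv u u.
Proof. by rewrite dotvvE; apply: sumr_ge0 => i _; exact: sqr_ge0. Qed.

Lemma dotvv_le0 u : dotv u u <= 0 -> u = 0.
Proof.
move=> u0; have /eqP : dotv u u = 0 by apply/eqP; rewrite eq_le u0 dotvv_ge0.
rewrite dotvvE psumr_eq0 => [/allP uu|i _]; last exact: sqr_ge0.
apply/matrixP => i j; rewrite ord1 mxE; apply/eqP.
by have := uu i (mem_index_enum _); rewrite /= sqrf_eq0.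
Qed.

Lemma lpnorm2E u : lpnorm 2 u = Num.sqrt (dotv u u).
Proof.
rewrite dotvvE /lpnorm powR12_sqrt; last first.
  by apply: sumr_ge0 => i _; exact: powR_ge0.
congr Num.sqrt; apply: eq_bigr => i _.
by rewrite powR_mulrn// real_normK ?num_real.
Qed.

Lemma lpnorm2_sqr u : lpnorm 2 u ^+ 2 = dotv u u.
Proof. by rewrite lpnorm2E sqr_sqrtr ?dotvv_ge0. Qed.

Lemma lpnorm1E u : lpnorm 1 u = l1norm u.
Proof.
rewrite l1norm.unlock /lpnorm invr1 powRr1; last first.
  by apply: sumr_ge0 => i _; exact: powR_ge0.
by apply: eq_bigr => i _; rewrite powRr1.
Qed.

Lemma l1norm_convex t u v : 0 <= t <= 1 ->
  l1norm (u + t *: v) <= (1 - t) * l1norm u + t * l1norm (u + v).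
Proof.
case/andP=> t0 t1; rewrite l1norm.unlock !mulr_sumr -big_split/=.
apply: ler_sum => i _; rewrite !mxE.
have -> : u i 0 + t * v i 0 = (1 - t) * u i 0 + t * (u i 0 + v i 0) by ring.
by rewrite (le_trans (ler_normD _ _))// !normrM (ger0_norm t0) ger0_norm ?subr_ge0.
Qed.

End dotv_theory.

(** Transposition written column by column, so that a bound on each [dotv (col j X) r] can be paired
    with the entries of [v]. *)
Lemma dotv_mulmx (R : realType) (k d : nat) (X : 'M[R]_(k, d)) r v :
  dotv r (X *m v) = \sum_(j < d) v j 0 * dotv (col j X) r.
Proof.
rewrite dotv.unlock; under eq_bigr do rewrite mxE mulr_sumr.
rewrite exchange_big; apply: eq_bigr => j _; rewrite mulr_sumr.
by apply: eq_bigr => i _; rewrite mxE; ring.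
Qed.

(** * Expansion and optimality of the elastic net *)

Lemma elastic_netE (R : realType) (N k d : nat) (X : 'M[R]_(k, d)) y
    (lambda tau : R) w :
  elastic_net N X y lambda tau w =
  (2 * N%:R)^-1 * dotv (X *m w - y) (X *m w - y) + lambda / 2 * dotv w w
  + tau * l1norm w.
Proof. by rewrite -!lpnorm2_sqr -lpnorm1E. Qed.

(** The smooth part is quadratic, so its second-order expansion is exact; the l1 term is kept as a
    difference. *)
Lemma elastic_netD (R : realType) (N k d : nat) (X : 'M[R]_(k, d)) y
    (lambda tau : R) w v :
  elastic_net N X y lambda tau (w + v) = elastic_net N X y lambda tau w
  + (N%:R^-1 * dotv (X *m w - y) (X *m v) + lambda * dotv w v
     + tau * (l1norm (w + v) - l1norm w))
  + ((2 * N%:R)^-1 * dotv (X *m v) (X *m v) + lambda / 2 * dotv v v).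
Proof.
rewrite [LHS]elastic_netE [in RHS]elastic_netE.
have -> : X *m (w + v) - y = (X *m w - y) + X *m v by rewrite mulmxDr addrAC.
move: (X *m w - y) (X *m v) => r z.
rewrite !dotvDl !dotvDr (dotvC z r) (dotvC v w) invfM.
by move: (N%:R^-1) => q; field.
Qed.

(* Compare [w] with [w + t *: v] and let [t] tend to 0: the l1 term is convex
   and the quadratic remainder is of order [t ^+ 2]. *)
Lemma elastic_net_optimality (R : realType) (N k d : nat) (X : 'M[R]_(k, d)) y
    (lambda tau : R) w v :
  0 < lambda -> 0 < tau -> is_argmin (elastic_net N X y lambda tau) w ->
  0 <= N%:R^-1 * dotv (X *m w - y) (X *m v) + lambda * dotv w v
     + tau * (l1norm (w + v) - l1norm w).
Proof.
move=> l0 tau0 wmin; set G := (X in 0 <= X).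
pose Q := (2 * N%:R)^-1 * dotv (X *m v) (X *m v) + lambda / 2 * dotv v v.
have Q0 : 0 <= Q.
  by rewrite addr_ge0// mulr_ge0 ?dotvv_ge0 ?invr_ge0 ?mulr_ge0 ?ler0n// ?ltW ?divr_gt0.
have GQ t : 0 < t -> t <= 1 -> 0 <= G + t * Q.
  move=> t0 t1; rewrite -(pmulr_rge0 _ t0).
  have := wmin (w + t *: v); rewrite elastic_netD -addrA lerDl => /le_trans; apply.
  rewrite -scalemxAr !dotvZr !dotvZl.
  have := l1norm_convex w v (t := t); rewrite (ltW t0) t1 => /(_ isT).
  move=> /(ler_wpM2l (ltW tau0)).
  rewrite /G /Q; nra.
rewrite leNgt; apply/negP => G0.
have D0 : 0 < Q - G by lra.
(* If [G < 0], this [t] lies in (0, 1] and makes [G + t * Q] equal to [- G ^+ 2 / (Q - G)], which is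
   negative. *)
have /GQ : 0 < - G / (Q - G) by rewrite divr_gt0//; lra.
have -> : - G / (Q - G) <= 1 by rewrite ler_pdivrMr//; lra.
move=> /(_ isT); apply/negP; rewrite -ltNge.
have -> : G + - G / (Q - G) * Q = - (G * G / (Q - G)) by field; lra.
by rewrite oppr_lt0 divr_gt0//; nra.
Qed.

(** * Sparsity and the cone argument *)

(** Cauchy-Schwarz against the indicator of [S], obtained by expanding the nonnegative sum of the
    squares [(s * f i - F) ^+ 2]. *)
Lemma sqr_sum_card (R : realType) (I : finType) (S : {set I}) (f : I -> R) :
  (\sum_(i in S) f i) ^+ 2 <= #|S|%:R * \sum_(i in S) f i ^+ 2.
Proof.
set F := \sum_(i in S) f i; set s : R := #|S|%:R.
have [S0|S0] := posnP #|S|.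
  by rewrite /F /s S0 mul0r (eq_bigl pred0) ?big_pred0_eq ?expr0n// => i; rewrite (cards0_eq S0) inE.
have s0 : 0 < s by rewrite ltr0n.
have : 0 <= \sum_(i in S) (s * f i - F) ^+ 2 by apply: sumr_ge0 => i _; exact: sqr_ge0.
have -> : \sum_(i in S) (s * f i - F) ^+ 2 =
    s * (s * (\sum_(i in S) f i ^+ 2) - F ^+ 2).
  under eq_bigr => i _.
    have -> : (s * f i - F) ^+ 2 = s ^+ 2 * f i ^+ 2 - 2 * s * F * f i + F ^+ 2.
      by ring.
    over.
  rewrite big_split/= sumrB -!mulr_sumr sumr_const -mulr_natl -/s -/F; ring.
by rewrite pmulr_rge0// subr_ge0.
Qed.

(* On the support [S] of [w] the l1 penalty drops by at most the mass of [v],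
   and off [S] it grows by the full mass of [v]. *)
Lemma lasso_cone (R : realType) (d : nat) (w v : 'cV[R]_d) (lambda sigma : R) :
  0 < lambda -> 0 <= sigma ->
  lambda / 2 * dotv v v + sigma * (l1norm (w + v) - l1norm w)
    <= 3 / 4 * sigma * l1norm v ->
  Num.sqrt (dotv v v) <= 28 * (sigma / lambda) * Num.sqrt (nnz w)%:R /\
  l1norm v <= 28 * (sigma / lambda) * (nnz w)%:R.
Proof.
move=> l0 s0.
pose S := [set i : 'I_d | w i 0 != 0]%SET.
pose a := \sum_(i in S) `|v i 0|; pose a' := \sum_(i | i \notin S) `|v i 0|.
have a0 : 0 <= a by exact: sumr_ge0.
have a'0 : 0 <= a' by exact: sumr_ge0.
have vE : l1norm v = a + a' by rewrite l1norm.unlock (bigID (mem S)).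
have wv : a' - a <= l1norm (w + v) - l1norm w.
  rewrite l1norm.unlock !(bigID (mem S) xpredT)/=.
  have -> : \sum_(i | i \notin S) `|w i 0| = 0.
    by apply: big1 => i; rewrite inE negbK => /eqP ->; rewrite normr0.
  have -> : \sum_(i | i \notin S) `|(w + v) i 0| = a'.
    by apply: eq_bigr => i; rewrite inE negbK mxE => /eqP ->; rewrite add0r.
  have : \sum_(i in S) `|w i 0| <= \sum_(i in S) `|(w + v) i 0| + a.
    rewrite -big_split; apply: ler_sum => i _; rewrite mxE.
    by have := ler_normD (w i 0 + v i 0) (- v i 0); rewrite addrK normrN.
  by lra.
set r := Num.sqrt (dotv v v); set q := Num.sqrt (nnz w)%:R.
have r0 : 0 <= r by exact: sqrtr_ge0.
have rE : r ^+ 2 = dotv v v by rewrite sqr_sqrtr ?dotvv_ge0.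
have q0 : 0 <= q by exact: sqrtr_ge0.
have qE : q ^+ 2 = (nnz w)%:R by rewrite sqr_sqrtr.
have ar : a <= q * r.
  rewrite -(@ler_pXn2r _ 2)// ?nnegrE ?mulr_ge0// exprMn qE rE.
  rewrite (le_trans (sqr_sum_card S _))// ler_wpM2l//.
  rewrite dotvvE [leRHS](bigID (mem S))/=.
  under eq_bigr do rewrite real_normK ?num_real//.
  by rewrite lerDl; apply: sumr_ge0 => i _; exact: sqr_ge0.
rewrite vE -rE -qE => H.
(* The noise adds 3/4 to the loss 1 on [S], and leaves 1 - 3/4 = 1/4 of the gain off [S]. *)
have main : lambda / 2 * r ^+ 2 + sigma * a' / 4 <= 7 / 4 * sigma * a.
  by have := ler_wpM2l s0 wv; lra.
set h := sigma / lambda.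
have h0 : 0 <= h by rewrite divr_ge0// ltW.
have sE : sigma = lambda * h by rewrite /h mulrC divfK// gt_eqF.
have hq : 0 <= h * q by exact: mulr_ge0.
have rb : r <= 7 / 2 * h * q.
  have : r * r <= 7 / 2 * h * q * r.
    rewrite -(ler_pM2l l0); have := ler_wpM2l s0 ar.
    by have := mulr_ge0 s0 a'0; move: main; rewrite sE; lra.
  have [->|rn0] := eqVneq r 0; first by lra.
  by rewrite ler_pM2r// lt_neqAle eq_sym rn0.
split; first by rewrite (le_trans rb)//; lra.
(* Bounding [a'] by [a] divides by [sigma]; when [sigma = 0], the bound on [r] already forces
   [v = 0]. *)
move: s0; rewrite le_eqVlt => /predU1P[s0|s1].
  have h00 : h = 0 by rewrite /h -s0 mul0r.
  have v0 : v = 0.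
    apply: dotvv_le0; rewrite -rE; move: rb; rewrite h00 mulr0 mul0r => rb.
    by nra.
  rewrite -vE v0 h00 mulr0 mul0r l1norm.unlock big1// => i _.
  by rewrite mxE normr0.
have a7 : a' <= 7 * a.
  rewrite -(ler_pM2l s1).
  by have := mulr_ge0 (ltW l0) (sqr_ge0 r); lra.
(* Here [a + a' <= 8 * a <= 8 * q * r], and 28 = 8 * 7/2. *)
have := ler_wpM2l q0 rb; lra.
Qed.

(** * From norms to inner products *)

(* Polarization with the balanced vectors [q x + p z] and [q x - p z]. *)
Lemma quasi_isometry_dotv (R : realType) (m n : nat) (M : 'M[R]_(m, n))
    (e p q : R) (x z : 'cV[R]_n) :
  0 <= e -> 0 <= p -> 0 <= q -> dotv x x <= p ^+ 2 -> dotv z z <= q ^+ 2 ->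
  (forall b : bool, let u := q *: x + ((-1) ^+ b * p) *: z in
    `|dotv (M *m u) (M *m u) - dotv u u| <= e * dotv u u) ->
  `|dotv (M *m x) (M *m z) - dotv x z| <= e * (p * q).
Proof.
move=> e0 p0 q0 xp zq H.
(* The polarized bound is divided by [p * q] at the end, so zero radii are settled first. *)
move: p0; rewrite le_eqVlt => /predU1P[p0|p0].
  have -> : x = 0 by apply: dotvv_le0; rewrite (le_trans xp)// -p0 expr0n.
  by rewrite mulmx0 ![dotv 0 _]dotvC !dotv0 subrr normr0 -p0 mul0r mulr0.
move: q0; rewrite le_eqVlt => /predU1P[q0|q0].
  have -> : z = 0 by apply: dotvv_le0; rewrite (le_trans zq)// -q0 expr0n.
  by rewrite mulmx0 !dotv0 subrr normr0 -q0 !mulr0.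
move: (H true) (H false) => /=; rewrite expr1 expr0.
rewrite !mulmxDr -!scalemxAr !dotvDl !dotvDr !dotvZl !dotvZr (dotvC z x).
rewrite (dotvC (M *m z) (M *m x)).
move: (dotv x x) (dotv z z) (dotv x z) xp zq => xx zz xz xp zq.
move: (dotv (M *m x) (M *m x)) (dotv (M *m z) (M *m z)) (dotv (M *m x) (M *m z)).
move=> sx sz s.
have pq0 : 0 < p * q by exact: mulr_gt0.
(* Balancing makes both squared terms at most [(p * q) ^+ 2]. The two bounds together control
   [4 * (p * q)] times the error by twice this left-hand side. *)
have bd : e * (q * (q * xx) + p * (p * zz)) <= e * (2 * (p * q) * (p * q)).
  apply: ler_wpM2l => //.
  have := ler_wpM2l (sqr_ge0 q) xp; have := ler_wpM2l (sqr_ge0 p) zq; lra.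
rewrite !ler_norml => /andP[h1 h2] /andP[h3 h4].
by apply/andP; split; rewrite -(ler_pM2l pq0); lra.
Qed.

(** * Union bounds *)

Section with_prob_ge_theory.
Context {disp : measure_display} {T : measurableType disp} {R : realType}.
Context (P : probability T R).
Implicit Types (p q : R) (A B : set T).

Lemma with_prob_ge_sub q A B :
  A `<=` B -> with_prob_ge P q A -> with_prob_ge P q B.
Proof.
by move=> AB [E [mE qE EA]]; exists E; split => //; exact: subset_trans AB.
Qed.

(** Subadditivity on the complements of the two witness events: failure probabilities add. *)
Lemma with_prob_ge_setI p q A B :
  with_prob_ge P (1 - p) A -> with_prob_ge P (1 - q) B ->
  with_prob_ge P (1 - (p + q)) (A `&` B).
Proof.
move=> [E [mE pE EA]] [F [mF qF FB]]; exists (E `&` F); split.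
- exact: measurableI.
- have : (P (~` (E `&` F)) <= P (~` E) + P (~` F))%E.
    by rewrite setCI; apply: measureU2; exact: measurableC.
  rewrite !probability_setC//; last exact: measurableI.
  move: pE qF.
  rewrite -(fineK (fin_num_measure P _ mE)) -(fineK (fin_num_measure P _ mF)).
  rewrite -(fineK (fin_num_measure P _ (measurableI _ _ mE mF))).
  by rewrite -!EFinB -EFinD !lee_fin; lra.
- exact: setISS.
Qed.

Lemma with_prob_ge_forall (I : finType) q (Q : I -> set T) :
  (forall i, with_prob_ge P (1 - q) (Q i)) ->
  with_prob_ge P (1 - #|I|%:R * q) [set omega | forall i, Q i omega].
Proof.
move=> H; rewrite cardE.
have : with_prob_ge P (1 - (size (enum I))%:R * q)
    [set omega | forall i, i \in enum I -> Q i omega].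
  elim: (enum I) => [|i s IH] /=.
    by exists setT; split => //; rewrite mul0r subr0 probability_setT.
  rewrite -natr1 mulrDl mul1r [_ * q + q]addrC.
  apply: (with_prob_ge_sub _ (with_prob_ge_setI (H i) IH)) => t [Qi Qs] j.
  by rewrite inE => /predU1P[->//|]; exact: Qs.
by apply: with_prob_ge_sub => t Qt i; apply: Qt; rewrite mem_enum.
Qed.

End with_prob_ge_theory.

(** * Johnson-Lindenstrauss for all columns at once *)

(* The union bound runs over the two polarization vectors of each column. *)
Lemma JL_dotv_columns (disp : measure_display) (T : measurableType disp)
    (R : realType) (P : probability T R) (m n d : nat)
    (A : 'I_m -> 'I_n -> {RV P >-> R}) (c delta p q : R) (X : 'M[R]_(n, d))
    (z : 'cV[R]_n) :
  0 < c -> (0 < d)%N -> 0 < delta -> delta < 1 / 2 -> JL_transform A c ->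
  0 <= p -> 0 <= q ->
  (forall j, dotv (col j X) (col j X) <= p ^+ 2) -> dotv z z <= q ^+ 2 ->
  with_prob_ge P (1 - delta)
    [set omega | forall j,
      `|dotv (random_mx A omega *m col j X) (random_mx A omega *m z)
        - dotv (col j X) z|
      <= 3 / 2 * c * Num.sqrt (ln (d%:R / delta) / m%:R) * (p * q)].
Proof.
move=> c0 d0 de0 de1 JL p0 q0 Xp zq.
have dR : 1 <= d%:R :> R by rewrite ler1n.
have dp : 0 < d%:R :> R by rewrite ltr0n.
(* An equal share of [delta] for each of the [2 d] vectors. *)
pose de := delta / (d%:R * 2).
have de_gt0 : 0 < de by rewrite divr_gt0// mulr_gt0.
have de_lt : de < 1 / 2 by rewrite ltr_pdivrMr ?mulr_gt0//; lra.
pose u (jb : 'I_d * bool) := q *: col jb.1 X + ((-1) ^+ jb.2 * p) *: z.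
have := with_prob_ge_forall (fun jb => JL (u jb) de de_gt0 de_lt).
rewrite card_prod card_ord card_bool natrM /de [_ * (delta / _)]mulrC divfK; last first.
  by rewrite mulf_neq0 ?gt_eqF.
apply: with_prob_ge_sub => t Ht j.
set e := c * Num.sqrt _ in Ht.
have e0 : 0 <= e by rewrite mulr_ge0 ?sqrtr_ge0 ?ltW.
have Hj : forall b : bool, let v := q *: col j X + ((-1) ^+ b * p) *: z in
    `|dotv (random_mx A t *m v) (random_mx A t *m v) - dotv v v| <= e * dotv v v.
  by move=> b v; rewrite -!lpnorm2_sqr; exact: (Ht (j, b)).
apply: (le_trans (quasi_isometry_dotv e0 p0 q0 (Xp j) zq Hj)).
apply: ler_wpM2r; first exact: mulr_ge0.
rewrite /e [3 / 2 * c]mulrC -mulrA ler_pM2l//.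
(* The factor 3/2 is a rational bound for the square root of 2: since [d / delta >= 2], the
   logarithm at most doubles, and 2 <= 9/4. *)
have -> : 3 / 2 = Num.sqrt ((3 / 2) ^+ 2) :> R by rewrite sqrtr_sqr ger0_norm.
rewrite -sqrtrM ?sqr_ge0// ler_wsqrtr// mulrA ler_wpM2r ?invr_ge0//.
have dd : 2 <= d%:R / delta by rewrite ler_pdivlMr//; lra.
have -> : 1 / (delta / (d%:R * 2)) = 2 * (d%:R / delta).
  by field; rewrite !gt_eqF.
rewrite lnM ?posrE//; last by lra.
have l2 : ln 2 <= ln (d%:R / delta) :> R by rewrite ler_ln ?posrE//; lra.
have l0 : 0 <= ln 2 :> R by rewrite ln_ge0//; lra.
lra.
Qed.

(** * Recovery error of the sketched minimizer *)

Theorem theorem2 (R : realType) (c a b : R) :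
  0 < c -> 0 < a -> 0 < b ->
  exists C : R, 0 < C /\
  forall (n m d : nat), (0 < n)%N -> (0 < m)%N -> (0 < d)%N ->
  forall (disp : measure_display) (T : measurableType disp)
    (P : probability T R) (A : 'I_m -> 'I_n -> {RV P >-> R}),
  JL_transform A c ->
  forall (X : 'M[R]_(n, d)) (y : 'cV[R]_n) (rho eta lambda tau delta sigma : R)
    (wstar : 'cV[R]_d) (what : T -> 'cV[R]_d),
  (forall j : 'I_d, lpnorm 2 (col j X) <= rho) ->
  0 < lambda -> 0 < tau -> 0 < delta -> delta < 1 / 2 ->
  is_argmin (elastic_net n X y lambda tau) wstar ->
  (forall omega : T,
     is_argmin (elastic_net n (random_mx A omega *m X) (random_mx A omega *m y)
                  lambda (tau + sigma)) (what omega)) ->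
  lpnorm 2 (X *m wstar - y) <= eta ->
  is_Theta a b (eta * rho / n%:R * Num.sqrt (ln (d%:R / delta) / m%:R)) sigma ->
  2 * c * eta * rho / n%:R * Num.sqrt (ln (d%:R / delta) / m%:R) <= sigma ->
  with_prob_ge P (1 - delta)
    [set omega | forall p : R, p = 1 \/ p = 2 ->
       lpnorm p (what omega - wstar)
       <= C * (eta * rho / (n%:R * lambda)
               * Num.sqrt ((nnz wstar)%:R `^ (2 / p)
                           * ln (d%:R / delta) / m%:R))].
Proof.
(* 28 comes from [lasso_cone], [b] from the upper half of [is_Theta]. *)
move=> c0 a0 b0; exists (28 * b); split; first by rewrite mulr_gt0.
move=> n m d n0 m0 d0 disp T P A JL X y rho eta lambda tau delta sigma w what.
move=> Xrho l0 t0 de0 de1 wmin whatmin weta [_ sb] sc.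
set e := X *m w - y in weta *.
set L := Num.sqrt (ln (d%:R / delta) / m%:R) in sb sc *.
have nR : 0 < n%:R :> R by rewrite ltr0n.
have L0 : 0 <= L by exact: sqrtr_ge0.
have eta0 : 0 <= eta by apply: le_trans weta; exact: powR_ge0.
have rho0 : 0 <= rho by apply: le_trans (Xrho (Ordinal d0)); exact: powR_ge0.
have s0 : 0 <= sigma.
  by apply: le_trans sc; rewrite !mulr_ge0// ?invr_ge0// ltW.
have Xrho2 j : dotv (col j X) (col j X) <= rho ^+ 2.
  by rewrite -lpnorm2_sqr ler_pXn2r// nnegrE; exact: powR_ge0.
have eeta2 : dotv e e <= eta ^+ 2.
  by rewrite -lpnorm2_sqr ler_pXn2r// nnegrE; exact: powR_ge0.
(* The residual [e] is independent of the outcome, so the column bound applies to it; from here on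
   the outcome [t] is fixed and the argument deterministic. *)
apply: (with_prob_ge_sub _
  (JL_dotv_columns c0 d0 de0 de1 JL rho0 eta0 Xrho2 eeta2)).
move=> t; set M := random_mx A t => Ht.
(* The ratio of 3/2 in the column bound to 2 in the lower bound on [sigma] is 3/4. *)
have Hj j : `|dotv (M *m col j X) (M *m e) - dotv (col j X) e|
    <= 3 / 4 * (n%:R * sigma).
  apply: (le_trans (Ht j)); rewrite -/L.
  move: sc; rewrite -(ler_pM2l nR).
  have -> : n%:R * (2 * c * eta * rho / n%:R * L) = 2 * (c * L * (rho * eta)).
    by field; rewrite gt_eqF.
  lra.
set v := what t - w.
have wE : what t = w + v by rewrite /v addrC subrK.
have opt := elastic_net_optimality v l0 t0 wmin.
have := whatmin t w.
rewrite wE elastic_netD -addrA gerDl -/M -!mulmxA -mulmxBr -/e => basic.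
(* Hölder between the sup norm and the l1 norm, term by term over the columns. *)
have noise : n%:R^-1 * dotv e (X *m v)
    - n%:R^-1 * dotv (M *m e) (M *m (X *m v)) <= 3 / 4 * sigma * l1norm v.
  rewrite -mulrBr mulrC ler_pdivrMr// mulmxA !dotv_mulmx -sumrB l1norm.unlock.
  rewrite mulr_sumr mulr_suml; apply: ler_sum => j _.
  have -> : col j (M *m X) = M *m col j X by rewrite !colE mulmxA.
  rewrite -mulrBr (le_trans (ler_norm _))// normrM distrC.
  have := ler_wpM2l (normr_ge0 (v j 0)) (Hj j); lra.
have q0 : 0 <= (2 * n%:R)^-1 * dotv (M *m (X *m v)) (M *m (X *m v)).
  by rewrite mulr_ge0 ?dotvv_ge0// invr_ge0 mulr_ge0// ltW.
(* [basic] minus [opt], with the sketched curvature [q0] dropped and [noise] on the right. *)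
have cone : lambda / 2 * dotv v v + sigma * (l1norm (w + v) - l1norm w)
    <= 3 / 4 * sigma * l1norm v by lra.
have [H2 H1] := lasso_cone l0 s0 cone.
have hb : 28 * (sigma / lambda) <= 28 * b * (eta * rho / (n%:R * lambda) * L).
  rewrite -mulrA ler_pM2l// ler_pdivrMr// (le_trans sb)//.
  by rewrite le_eqVlt; apply/orP; left; apply/eqP; field; rewrite !gt_eqF.
(* Splits off the sparsity factor, whose root is [s] for [p = 1] and the square root of [s] for
   [p = 2]. *)
have sE x : 0 <= x -> Num.sqrt (x * ln (d%:R / delta) / m%:R) = Num.sqrt x * L.
  by move=> x0; rewrite -mulrA sqrtrM.
rewrite -/v => p [->|->]; rewrite sE ?powR_ge0//.
  rewrite divr1 powR_mulrn// sqrtr_sqr ger0_norm// lpnorm1E (le_trans H1)//.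
  by have := ler_wpM2r (ler0n R (nnz w)) hb; lra.
rewrite divff// powRr1// lpnorm2E (le_trans H2)//.
by have := ler_wpM2r (sqrtr_ge0 (nnz w)%:R) hb; lra.
Qed.
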